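(* Let $K=\sigma^y\otimes A$ be the $2M\times 2M$ matrix attached to a finite irreducible reversible generator $Q$ as described in the context. Then $$K^{T}=-K\qquad\text{and}\qquad K^{*}=K,$$ that is, $K$ is antisymmetric for the transpose and Hermitian for the conjugate transpose. For $z\in\mathbb{C}$ set $W_z:=e^{zK}$. Then $z\mapsto W_z$ is an entire homomorphism from $(\mathbb{C},+)$ into $\mathrm{O}(2M,\mathbb{C})$, with $$W_{z+w}=W_zW_w,\qquad W_0=\mathrm{I},\qquad W_z^{T}W_z=\mathrm{I}\qquad (z,w\in\mathbb{C}),$$ and it has the closed block form $$W_z=\begin{pmatrix}\cosh(zA)&-i\sinh(zA)\\ i\sinh(zA)&\cosh(zA)\end{pmatrix}.$$
   Context: Let $M\ge 2$ and let $Q=(Q_{ij})_{1\le i,j\le M}$ be the generator of an irreducible continuous-time Markov chain: $Q_{ij}\ge0$ for $i\neq j$ and $Q_{ii}=-\sum_{j\ne i}Q_{ij}$. Let $\nu$ be its unique stationary probability vector (strictly positive, $Q^{T}\nu=0$), and assume reversibility (detailed balance): $\nu_iQ_{ij}=\nu_jQ_{ji}$ for all $i,j$. Fix a uniformisation rate $\Lambda>0$ with $\Lambda\ge\max_i(-Q_{ii})$ and set $P:=\mathrm{I}+\tfrac1\Lambda Q$, $D:=\mathrm{diag}(\sqrt{\nu_1},\dots,\sqrt{\nu_M})$, $A:=DPD^{-1}$ (a real symmetric matrix by reversibility). Let $\sigma^y=\begin{pmatrix}0&-i\\ i&0\end{pmatrix}$ and $K:=\sigma^y\otimes A=\begin{pmatrix}0&-iA\\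 iA&0\end{pmatrix}$. Here ${}^T$ is the plain transpose (no conjugation), ${}^*$ the conjugate transpose, and $\mathrm{O}(N,\mathbb{C})=\{W\in\mathbb{C}^{N\times N}:W^{T}W=\mathrm{I}\}$. *)

(* Defs.v *)
From HB Require Import structures.
From mathcomp Require Import all_boot all_order all_algebra.
From mathcomp Require Import complex mxtens.
From mathcomp Require Import all_classical all_reals all_analysis.

Set Implicit Arguments.
Unset Strict Implicit.
Unset Printing Implicit Defensive.

Import Order.TTheory GRing.Theory Num.Theory.
Import numFieldNormedType.Exports.

Local Open Scope classical_set_scope.
Local Open Scope complex_scope.
Local Open Scope ring_scope.

Section ReversibleGenerator.
Variables (R : realType) (M : nat).
Implicit Types (Q : 'M[R]_M) (nu : 'cV[R]_M) (Lam : R).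

Definition is_generator Q : Prop :=
  (forall i j, i != j -> 0 <= Q i j) /\
  (forall i, Q i i = - \sum_(j | j != i) Q i j).

(* The diagonal of a generator is nonpositive, so the relation 0 < Q k l only
   relates distinct states. *)
Definition is_irreducible Q : Prop :=
  forall i j, connect [rel k l | 0 < Q k l] i j.

Definition is_stationary Q nu : Prop :=
  [/\ forall i, 0 <= nu i 0, \sum_i nu i 0 = 1 & Q^T *m nu = 0].

Definition is_reversible Q nu : Prop :=
  forall i j, nu i 0 * Q i j = nu j 0 * Q j i.

Lemma is_stationary_gt0 Q nu :
  is_generator Q -> is_irreducible Q -> is_stationary Q nu ->
  forall i, 0 < nu i 0.
Proof.
move=> [Qoff _] Qirr [nu_ge0 nu_sum nu_stat] i.
have [k nuk_gt0] : exists k, 0 < nu k 0.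
  apply: contrapT => /forallNP nu_le0.
  have := oner_neq0 R; rewrite -nu_sum big1 ?eqxx // => k _.
  by apply/eqP; rewrite eq_le nu_ge0 andbT leNgt; apply/negP/nu_le0.
have step k1 k2 : 0 < Q k1 k2 -> 0 < nu k1 0 -> 0 < nu k2 0.
  move=> Q12 nu1; rewrite lt_neqAle nu_ge0 andbT eq_sym; apply/negP => /eqP nu2.
  have /matrixP/(_ k2 0) := nu_stat; rewrite !mxE => sum0.
  have pos l : true -> 0 <= Q^T k2 l * nu l 0.
    rewrite mxE; have [->|lk2] := eqVneq l k2; first by rewrite nu2 mulr0.
    by rewrite mulr_ge0 // Qoff.
  have := psumr_eq0P pos sum0 (isT : (fun=> true) k1).
  by rewrite mxE => /eqP; rewrite gt_eqF // mulr_gt0.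
have /connectP[p] := Qirr k i.
elim: p k nuk_gt0 => [|l p IHp] k nuk /=; first by move=> _ ->.
by move=> /andP[kl lp]; apply: IHp lp; apply: step kl nuk.
Qed.

Definition uniformised Lam Q : 'M[R]_M := 1%:M + Lam^-1 *: Q.

Definition sqrt_diag nu : 'M[R]_M := diag_mx (\row_i Num.sqrt (nu i 0)).

Definition symmetrised Lam Q nu : 'M[R]_M :=
  sqrt_diag nu *m uniformised Lam Q *m invmx (sqrt_diag nu).

End ReversibleGenerator.

Section ComplexMatrices.
Variable R : realType.
Local Notation C := (R[i]).

Definition complexmx m n (B : 'M[R]_(m, n)) : 'M[C]_(m, n) :=
  map_mx (real_complex R) B.

Definition sigma_y : 'M[C]_(1 + 1) :=
  block_mx 0 (- 'i%C)%:M 'i%C%:M 0.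

Lemma double_dim M : ((1 + 1) * M = M + M)%N.
Proof. by rewrite mul2n addnn. Qed.

(* tensmx is the Kronecker product, of size (1 + 1) * M; the cast only rewrites
   that dimension as M + M so that block_mx applies. *)
Definition sigma_y_tens M (A : 'M[C]_M) : 'M[C]_(M + M) :=
  castmx (double_dim M, double_dim M) (tensmx sigma_y A).

Lemma sigma_y_tensE M (A : 'M[C]_M) :
  sigma_y_tens A = block_mx 0 (- 'i%C *: A) ('i%C *: A) 0.
Proof.
have idxl (i : 'I_M) : mxtens_unindex
    (cast_ord (esym (double_dim M)) (lshift M i)) = (lshift 1 0, i).
  rewrite -[RHS]mxtens_indexK; congr mxtens_unindex.
  by apply: val_inj; rewrite /= mul0n add0n.
have idxr (i : 'I_M) : mxtens_unindex
    (cast_ord (esym (double_dim M)) (rshift M i)) = (rshift 1 0, i).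
  rewrite -[RHS]mxtens_indexK; congr mxtens_unindex.
  by apply: val_inj; rewrite /= mul1n.
apply/matrixP => i j; rewrite /sigma_y_tens castmxE mxE /sigma_y.
case: (split_ordP i) => k ->; case: (split_ordP j) => l ->;
  rewrite ?(idxl, idxr) /= ?(block_mxEul, block_mxEur, block_mxEdl, block_mxEdr);
  by rewrite !mxE ?mul0r ?eqxx ?mulr1n.
Qed.

End ComplexMatrices.

Section MatrixFunctions.
Variable K : numFieldType.

(* The limit is taken in the (entrywise) topology of 'M[K]_n. *)
Definition expmx n (B : 'M[K]_n) : 'M[K]_n :=
  lim (series (fun k => (k`!%:R : K)^-1 *: B ^+ k) @ \oo).

Definition coshmx n (B : 'M[K]_n) : 'M[K]_n :=
  2^-1 *: (expmx B + expmx (- B)).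

Definition sinhmx n (B : 'M[K]_n) : 'M[K]_n :=
  2^-1 *: (expmx B - expmx (- B)).

Definition orthogonal_group N : set 'M[K]_N := [set W | W^T *m W = 1%:M].

(* The increment in derivable ranges over the scalar field K, so for K = R[i]
   this is complex differentiability at every point of the plane. *)
Definition entire m n (f : K -> 'M[K]_(m, n)) : Prop :=
  forall z : K, derivable f z 1.

End MatrixFunctions.

Arguments orthogonal_group : clear implicits.

(* Main.v *)
Require Import Defs.
From HB Require Import structures.
From mathcomp Require Import all_boot all_order all_algebra.
From mathcomp Require Import complex mxtens.
From mathcomp Require Import all_classical all_reals all_analysis.

Import Order.TTheory GRing.Theory Num.Theory.
Import numFieldNormedType.Exports.

Set Implicit Arguments.
Unset Strict Implicit.

Local Open Scope classical_set_scope.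
Local Open Scope complex_scope.
Local Open Scope sesquilinear_scope.
Local Open Scope ring_scope.

(** The matrix exponential is handled directly through its power series, for
an arbitrary complex matrix [B]; no diagonalisation is used.

Let [b] be the sum of the moduli of the entries of [B]. Every entry of [B ^+ k]
has modulus at most [b ^+ k] ([norm_exprmx_le]), so the series of [B] is
dominated, entry by entry, by the real series of [expR b]. Three facts about
[expmx] are read off from the real exponential in this way:
- the series converges ([cvg_expmx]);
- [expmx (B + D) = expmx B *m expmx D] when [B] and [D] commute ([expmxD]): the
  product of two partial sums differs from the partial sum of [B + D] by the
  terms above the antidiagonal of a square, and these are dominated, up to the
  size of the matrices, by the same terms for the numbers [b] and [d] attached to
  [B] and [D], whose sum tends to [expR b * expR d - expR (b + d) = 0];
- [expmx B] differs from [1 + B] by at most [b ^+ 2 * expR b]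
  ([expmx_remainder_le]), so [expmx (h *: B)] has derivative [B] at [h = 0], and
  the addition formula moves this to every point ([entire_expmxZ]).

The closed form comes from the eigenspaces of sigma_y, whose eigenvalues are 1
and -1. With [p] and [q] the two spectral projections, the map that sends
[(X, Y)] to the sum of the Kronecker products of [p] with [X] and of [q] with [Y]
is a continuous morphism of algebras ([eigen_blocksM], [cvg_eigen_blocks]), hence
commutes with [expmx] ([expmx_eigen_blocks]). It sends [(B, - B)] to the
Kronecker product of sigma_y and [B], and [(expmx B, expmx (- B))] to the block
matrix of hyperbolic functions.

Finally detailed balance makes [A] symmetric ([symmetrised_sym]). As [A] is also
real, [K] is antisymmetric and Hermitian, and orthogonality of [W z] is the
addition formula applied to [z *: K] and its transpose [- z *: K]. *)

(** * Limits of matrices *)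

Lemma cvg_mx_entry (K : numFieldType) (m n : nat) (T : Type)
    (F : set_system T) {FF : Filter F} (f : T -> 'M[K]_(m, n)) (L : 'M[K]_(m, n)) :
  (forall i j, f t i j @[t --> F] --> L i j) <-> f t @[t --> F] --> L.
Proof.
split=> [fL|fL i j]; last first.
  exact: cvg_comp fL (@coord_continuous _ m n i j L).
rewrite [L]matrix_sum_delta.
under eq_cvg do rewrite [f _]matrix_sum_delta.
apply: cvg_big => [|i _]; first by move=> x; exact: add_continuous.
apply: cvg_big => [|j _]; first by move=> x; exact: add_continuous.
exact: cvgZr_tmp.
Qed.

Lemma cvg_mulmx (K : numFieldType) (m n p : nat) (T : Type)
    (F : set_system T) {FF : Filter F} (f : T -> 'M[K]_(m, n))
    (g : T -> 'M[K]_(n, p)) (L : 'M[K]_(m, n)) (L' : 'M[K]_(n, p)) :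
  f t @[t --> F] --> L -> g t @[t --> F] --> L' ->
  f t *m g t @[t --> F] --> L *m L'.
Proof.
move=> /cvg_mx_entry fL /cvg_mx_entry gL; apply/cvg_mx_entry => i j.
rewrite mxE; under eq_cvg do rewrite mxE.
apply: cvg_big => [|k _]; first by move=> x; exact: add_continuous.
exact: cvgM.
Qed.

Lemma cvg_trmx (K : numFieldType) (m n : nat) (T : Type)
    (F : set_system T) {FF : Filter F} (f : T -> 'M[K]_(m, n)) (L : 'M[K]_(m, n)) :
  f t @[t --> F] --> L -> (f t)^T @[t --> F] --> L^T.
Proof.
move=> /cvg_mx_entry fL; apply/cvg_mx_entry => i j; rewrite mxE.
by under eq_cvg do rewrite mxE; exact: fL.
Qed.

Lemma cvg_block_mx (K : numFieldType) (m1 m2 n1 n2 : nat) (T : Type)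
    (F : set_system T) {FF : Filter F}
    (f : T -> 'M[K]_(m1, n1)) (g : T -> 'M[K]_(m1, n2))
    (h : T -> 'M[K]_(m2, n1)) (k : T -> 'M[K]_(m2, n2))
    (A : 'M[K]_(m1, n1)) (B : 'M[K]_(m1, n2))
    (A' : 'M[K]_(m2, n1)) (B' : 'M[K]_(m2, n2)) :
  f t @[t --> F] --> A -> g t @[t --> F] --> B ->
  h t @[t --> F] --> A' -> k t @[t --> F] --> B' ->
  block_mx (f t) (g t) (h t) (k t) @[t --> F] --> block_mx A B A' B'.
Proof.
move=> /cvg_mx_entry fA /cvg_mx_entry gB /cvg_mx_entry hA /cvg_mx_entry kB.
apply/cvg_mx_entry => i j.
case: (split_ordP i) => i' ->; case: (split_ordP j) => j' ->;
  rewrite ?(block_mxEul, block_mxEur, block_mxEdl, block_mxEdr);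
  under eq_cvg do rewrite ?(block_mxEul, block_mxEur, block_mxEdl, block_mxEdr).
- exact: fA.
- exact: gB.
- exact: hA.
- exact: kB.
Qed.

(** * Limits controlled by the norm *)

(** Squeezing in a [numFieldType], where the order is only partial: the bound [v]
is automatically nonnegative, hence real, wherever it dominates a norm. *)
Lemma cvg0_norm_le (K : numFieldType) (T : Type) (F : set_system T) {FF : Filter F}
    (f v : T -> K) :
  (\forall t \near F, `|f t| <= v t) -> v t @[t --> F] --> 0 -> f t @[t --> F] --> 0.
Proof.
move=> fv /cvgr0Pnorm_lt v0; apply/cvgr0Pnorm_lt => e e0.
near=> t; have ft : `|f t| <= v t by near: t.
have vt : `|v t| < e by near: t; exact: v0.
apply: (le_lt_trans ft); apply: le_lt_trans vt.
by apply/real_ler_norm/ger0_real; exact: le_trans ft.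
Unshelve. all: by end_near. Qed.

Lemma norm_cvg_le (K : numFieldType) (T : Type) (F : set_system T) {FF : ProperFilter F}
    (f : T -> K) (l c : K) :
  (\forall t \near F, `|f t| <= c) -> f t @[t --> F] --> l -> `|l| <= c.
Proof.
move=> fc /cvgrPdist_lt fl; apply/ler_addgt0Pr => e e0.
near F => t.
have ft : `|f t| <= c by near: t.
have lt : `|l - f t| < e by near: t; exact: fl.
rewrite -(subrK (f t) l) addrC; apply: le_trans (ler_normD _ _) _.
by apply: lerD => //; exact: ltW.
Unshelve. all: by end_near. Qed.

Lemma near0_norm_le1 (K : numFieldType) : \forall h \near (0 : K), `|h| <= 1.
Proof. exact: (@nbhs0_le K K). Qed.

Lemma cvg_norm_mulr0 (K : numFieldType) (c : K) :
  `|h| * c @[h --> (0 : K)^'] --> (0 : K).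
Proof.
rewrite -[X in _ --> X](mul0r c) -[X in X * _](normr0 K).
by apply: cvgMr_tmp; apply: cvg_norm; exact: nbhs_dnbhs.
Qed.

(** A quadratic remainder [O(`|h| ^+ 2)] leaves an error of order [`|h|] after
division by [h]. *)
Lemma cvg_mx_difference_quotient (K : numFieldType) (m n : nat)
    (f : K -> 'M[K]_(m, n)) (A B : 'M[K]_(m, n)) (c : K) :
  (\forall h \near 0, forall i j, `|(f h - A - h *: B) i j| <= `|h| ^+ 2 * c) ->
  h^-1 *: (f h - A) @[h --> 0^'] --> B.
Proof.
move=> fc; apply/cvg_mx_entry => i j; apply/subr_cvg0.
apply: (cvg0_norm_le _ (cvg_norm_mulr0 c)); near=> h.
have h0 : h != 0 by near: h; exact: nbhs_dnbhs_neq.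
have : `|(f h - A - h *: B) i j| <= `|h| ^+ 2 * c.
  by move: i j; near: h; exact: nbhs_dnbhs.
have -> : (f h - A - h *: B) i j = h * ((h^-1 *: (f h - A)) i j - B i j).
  by rewrite !mxE mulrBr mulrA divff // mul1r.
by rewrite normrM expr2 -mulrA ler_pM2l // normr_gt0.
Unshelve. all: by end_near. Qed.

(** * Spectral decomposition of sigma_y *)

Definition expterm (K : numFieldType) (n : nat) (B : 'M[K]_n) (k : nat) : 'M[K]_n :=
  (k`!%:R)^-1 *: B ^+ k.

Lemma scale_half_double (K : numFieldType) (V : lmodType K) (v : V) :
  (2^-1 : K) *: (v + v) = v.
Proof. by rewrite -mulr2n -[v *+ _]scaler_nat scalerA mulVf ?pnatr_eq0 // scale1r. Qed.

Section EigenBlocks.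
Variables (K : numFieldType) (n : nat) (c : K).
Implicit Types X Y : 'M[K]_n.

(** For [d ^+ 2 = -1], the 2 x 2 matrix with rows [(1, - d)] and [(d, 1)], divided by
2, is an idempotent: the projection on the eigenvalue 1 of the matrix with rows
[(0, - d)] and [(d, 0)]. The block matrix is its Kronecker product with [X].
Sigma_y is the case where [d] is the imaginary unit, and [- d] gives the
complementary projection. *)
Definition eigen_block (d : K) X : 'M[K]_(n + n) :=
  2^-1 *: block_mx X (- d *: X) (d *: X) X.

Definition eigen_blocks X Y : 'M[K]_(n + n) := eigen_block c X + eigen_block (- c) Y.

Lemma eigen_blocksE X Y : eigen_blocks X Y =
  block_mx (2^-1 *: (X + Y)) (- c *: (2^-1 *: (X - Y)))
           (c *: (2^-1 *: (X - Y))) (2^-1 *: (X + Y)).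
Proof.
rewrite /eigen_blocks /eigen_block -scalerDr add_block_mx scale_block_mx opprK.
have cBE d : d *: X + - d *: Y = d *: (X - Y) by rewrite scalerBr scaleNr.
by rewrite -{2}[c]opprK !cBE !scalerA ![2^-1 * _]mulrC.
Qed.

Lemma eigen_blockM (d : K) X X' : d ^+ 2 = -1 ->
  eigen_block d X *m eigen_block d X' = eigen_block d (X *m X').
Proof.
move=> d2; have dZ Y : - d *: (d *: Y) = Y.
  by rewrite scalerA mulNr -expr2 d2 opprK scale1r.
have dZ' Y : d *: (- d *: Y) = Y.
  by rewrite scalerA mulrN -expr2 d2 opprK scale1r.
rewrite /eigen_block -scalemxAl -scalemxAr mulmx_block.
rewrite -!scalemxAl -!scalemxAr dZ dZ' -add_block_mx.
by congr (_ *: _); exact: scale_half_double.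
Qed.

Lemma eigen_block_orth (d : K) X Y : d ^+ 2 = -1 ->
  eigen_block d X *m eigen_block (- d) Y = 0.
Proof.
move=> d2; have dZ Z : d *: (d *: Z) = - Z by rewrite scalerA -expr2 d2 scaleN1r.
rewrite /eigen_block -scalemxAl -scalemxAr mulmx_block.
rewrite !opprK !scaleNr !mulNmx !mulmxN -!scalemxAl -!scalemxAr dZ.
by rewrite !(opprK, subrr, addNr) block_mx0 !scaler0.
Qed.

(** The cross terms vanish because the two projections are orthogonal. *)
Lemma eigen_blocksM X Y X' Y' : c ^+ 2 = -1 ->
  eigen_blocks X Y *m eigen_blocks X' Y' = eigen_blocks (X *m X') (Y *m Y').
Proof.
move=> c2; have cN2 : (- c) ^+ 2 = -1 by rewrite sqrrN.
have orthN : eigen_block (- c) Y *m eigen_block c X' = 0.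
  by have := eigen_block_orth Y X' cN2; rewrite opprK.
by rewrite mulmxDl !mulmxDr !eigen_blockM // orthN eigen_block_orth // addr0 add0r.
Qed.

Lemma eigen_blocks1 : eigen_blocks 1%:M 1%:M = 1%:M.
Proof.
by rewrite eigen_blocksE subrr !scaler0 scale_half_double -scalar_mx_block.
Qed.

Lemma eigen_blocksX X Y k : c ^+ 2 = -1 ->
  eigen_blocks X Y ^+ k = eigen_blocks (X ^+ k) (Y ^+ k).
Proof.
move=> c2; elim: k => [|k IHk]; first by rewrite !expr0 eigen_blocks1.
by rewrite !exprS IHk; exact: eigen_blocksM.
Qed.

Lemma eigen_block_linear (d a : K) X Y :
  eigen_block d (a *: X + Y) = a *: eigen_block d X + eigen_block d Y.
Proof.
rewrite /eigen_block [a *: (_ *: _)]scalerA [a * _]mulrC -scalerA -scalerDr;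
  congr (_ *: _).
by rewrite scale_block_mx add_block_mx !scalerDr !scalerA !mulrN !mulNr ![_ * a]mulrC.
Qed.

Lemma eigen_blocks_linear (a : K) X Y X' Y' :
  eigen_blocks (a *: X + X') (a *: Y + Y') =
  a *: eigen_blocks X Y + eigen_blocks X' Y'.
Proof. by rewrite /eigen_blocks !eigen_block_linear scalerDr addrACA. Qed.

Lemma eigen_blocksZ (a : K) X Y :
  a *: eigen_blocks X Y = eigen_blocks (a *: X) (a *: Y).
Proof.
have := eigen_blocks_linear a X Y 0 0.
by rewrite [eigen_blocks 0 0]eigen_blocksE subrr !(addr0, scaler0) block_mx0 addr0.
Qed.

(** The difference of the two projections is sigma_y itself. *)
Lemma eigen_blocksN X :
  eigen_blocks X (- X) = block_mx 0 (- c *: X) (c *: X) 0.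
Proof. by rewrite eigen_blocksE subrr opprK scaler0 scale_half_double. Qed.

Lemma series_expterm_eigen_blocks X Y N : c ^+ 2 = -1 ->
  series (expterm (eigen_blocks X Y)) N =
  eigen_blocks (series (expterm X) N) (series (expterm Y) N).
Proof.
move=> c2; rewrite /series /=; elim: N => [|N IHN].
  by rewrite !big_geq // eigen_blocksE !(addr0, subr0, scaler0) block_mx0.
rewrite !big_nat_recr //= IHN [expterm (eigen_blocks _ _) _]/expterm eigen_blocksX // addrC.
by rewrite -eigen_blocks_linear ![_ + \sum_(_ <= _ < _) _]addrC.
Qed.

Lemma cvg_eigen_blocks (T : Type) (F : set_system T) {FF : Filter F}
    (f g : T -> 'M[K]_n) X Y :
  f t @[t --> F] --> X -> g t @[t --> F] --> Y ->
  eigen_blocks (f t) (g t) @[t --> F] --> eigen_blocks X Y.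
Proof.
move=> fX gY; rewrite eigen_blocksE; under eq_cvg do rewrite eigen_blocksE.
apply: cvg_block_mx; do ?apply: cvgZl_tmp; [exact: cvgD|exact: cvgB|exact: cvgB|exact: cvgD].
Qed.

End EigenBlocks.

(** * Products of exponential series *)

(** A square of indices cut along its antidiagonal [i + j = N]; the lower triangle
is summed by antidiagonals, as in the Cauchy product of two series. *)
Lemma sum_nat_triangle (V : zmodType) (N : nat) (F : nat -> nat -> V) :
  \sum_(0 <= i < N) \sum_(0 <= j < N) F i j =
  \sum_(0 <= k < N) \sum_(0 <= i < k.+1) F i (k - i)%N
  + \sum_(0 <= i < N) \sum_(N - i <= j < N) F i j.
Proof.
have -> : \sum_(0 <= k < N) \sum_(0 <= i < k.+1) F i (k - i)%N =
    \sum_(0 <= i < N) \sum_(0 <= j < N - i) F i j.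
  elim: N => [|N IHN]; first by rewrite !big_geq.
  rewrite !big_nat_recr //= IHN subSnn big_nat1 subnn addrA -big_split /=.
  congr (_ + _); apply: eq_big_nat => i /andP[_ iN].
  by rewrite subSn 1?ltnW// big_nat_recr.
rewrite -big_split /=; apply: eq_big_nat => i _.
by rewrite -big_cat_nat // leq_subr.
Qed.

Lemma invf_fact_bin (K : numFieldType) (k i : nat) : (i <= k)%N ->
  (k`!%:R : K)^-1 * 'C(k, i)%:R = i`!%:R^-1 * (k - i)`!%:R^-1.
Proof.
move=> ik; rewrite -(bin_fact ik) !natrM !invfM mulrC mulVKf //.
by rewrite pnatr_eq0 -lt0n bin_gt0.
Qed.

Section RealExponential.
Variable R : realType.

Lemma exp_coeffD (x y : R) (k : nat) :
  exp_coeff (x + y) k = \sum_(0 <= i < k.+1) exp_coeff x i * exp_coeff y (k - i)%N.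
Proof.
rewrite /exp_coeff /= addrC exprDn_comm; last exact: mulrC.
rewrite mulr_suml big_mkord; apply: eq_bigr => i _.
rewrite -mulr_natr -mulrA [_%:R / _]mulrC invf_fact_bin -1?ltnS //.
by rewrite [y ^+ _ * _]mulrC mulrACA.
Qed.

Lemma series_exp_coeff_le_expR (x : R) N : 0 <= x -> series (exp_coeff x) N <= expR x.
Proof.
move=> x0; apply: nondecreasing_cvgn_le; last exact: is_cvg_series_exp_coeff.
by apply: nondecreasing_series => k _ _; exact: exp_coeff_ge0.
Qed.

End RealExponential.

Section ComplexExponential.
Variable R : realType.
Local Notation C := (R[i] : numFieldType).

(** * Real bounds for complex numbers *)

(** The inclusion of the reals, with values in the [numFieldType] of complex
numbers, since norms and limits are those attached to that structure. *)
Definition embC (x : R) : C := x%:C.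
Local Notation "x %:rc" := (embC x) (at level 2, format "x %:rc") : ring_scope.

Lemma embC_le (x y : R) : (x%:rc <= y%:rc) = (x <= y).
Proof. exact: lecR. Qed.

Lemma embC_lt (x y : R) : (x%:rc < y%:rc) = (x < y).
Proof. exact: ltcR. Qed.

Lemma embC_is_additive : additive embC.
Proof. by move=> x y; rewrite /embC rmorphB. Qed.

Lemma embC_is_multiplicative : multiplicative embC.
Proof. by split=> [x y|]; rewrite /embC ?rmorphM ?rmorph1. Qed.

HB.instance Definition _ := GRing.isAdditive.Build R C embC embC_is_additive.
HB.instance Definition _ := GRing.isMultiplicative.Build R C embC embC_is_multiplicative.

Lemma normc_real (x : R) : `|x%:rc| = `|x|%:rc.
Proof. by rewrite /embC; have := normc_def x%:C; rewrite /= expr0n addr0 sqrtr_sqr. Qed.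

Lemma gt0_embC (e : C) : 0 < e -> exists2 d, 0 < d & e = d%:rc.
Proof.
move=> e0; have eR : (complex.Re e)%:rc = e by exact: (RRe_real (gtr0_real e0)).
by exists (complex.Re e) => //; rewrite -embC_lt eR.
Qed.

(** The norm of a [numFieldType] takes its values in the field itself; this is the
modulus as an element of [R], where the real exponential can be applied to it. *)
Definition cabs (z : C) : R := complex.Re (`|z| : C).

Lemma cabsE (z : C) : (cabs z)%:rc = `|z|.
Proof. exact: (RRe_real (normr_real z)). Qed.

Lemma cvg_real_complex (T : Type) (F : set_system T) {FF : Filter F}
    (f : T -> R) (l : R) :
  f t @[t --> F] --> l -> (f t)%:rc @[t --> F] --> l%:rc.
Proof.
move=> /cvgrPdist_lt fl; apply/cvgrPdist_lt => _ /gt0_embC[e e0 ->].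
have /= := fl _ e0; apply: filterS => t.
by rewrite -rmorphB normc_real embC_lt.
Qed.

(** The real and imaginary parts of [u] are dominated by [v] too, so absolute
convergence in [R] applies to each of them. *)
Lemma cvg_series_complex (u : nat -> C) (v : nat -> R) :
  (forall k, `|u k| <= (v k)%:rc) -> cvgn (series v) -> cvgn (series u).
Proof.
move=> uv cv.
have v0 k : 0 <= v k by rewrite -embC_le rmorph0; exact: le_trans (normr_ge0 _) (uv k).
have cvp (p : R[i] -> R) : (forall z : C, `|p z|%:rc <= `|z|) ->
    cvgn (series (p \o u)).
  move=> pz; apply: normed_cvg; apply: series_le_cvg cv => //= k.
  by rewrite -embC_le; exact: le_trans (pz (u k)) (uv k).
have Im_le (z : C) : `|complex.Im z|%:rc <= `|z|.
  have /= := normc_ge_Re ('i%C * z); rewrite mulrC ReiNIm normrN normrM.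
  by rewrite (_ : `|'i%C| = 1) ?mulr1// complexiE normCi.
have /cvg_ex[a ca] := cvp (@complex.Re R) (@normc_ge_Re _).
have /cvg_ex[b cb] := cvp (@complex.Im R) Im_le.
apply/cvg_ex; exists (a%:rc + ('i%C : C) * b%:rc : C).
rewrite (_ : series u = fun n => (series (@complex.Re R \o u) n)%:rc
                    + ('i%C : C) * (series (@complex.Im R \o u) n)%:rc); last first.
  apply/funext => n; rewrite /series /= !rmorph_sum mulr_sumr -big_split /=.
  by apply: eq_bigr => k _; exact: complexE.
apply: cvgD; first exact: cvg_real_complex.
by apply: cvgMl_tmp; exact: cvg_real_complex.
Qed.

(** * The exponential of a complex matrix *)

Section MatrixExponential.
Variable n : nat.
Implicit Types B D : 'M[C]_n.

Definition mxl1 B : R := \sum_i \sum_j cabs (B i j).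

Lemma mxl1E B : (mxl1 B)%:rc = \sum_i \sum_j `|B i j|.
Proof.
rewrite rmorph_sum; apply: eq_bigr => i _.
by rewrite rmorph_sum; apply: eq_bigr => j _; exact: cabsE.
Qed.

Lemma mxl1_ge0 B : 0 <= mxl1 B.
Proof. by rewrite -embC_le rmorph0 mxl1E sumr_ge0 // => i _; rewrite sumr_ge0. Qed.

Lemma mxl1Z (z : C) B : mxl1 (z *: B) = cabs z * mxl1 B.
Proof.
apply: (@complexI R); rewrite -!/(embC _) rmorphM /= cabsE !mxl1E mulr_sumr.
apply: eq_bigr => i _; rewrite mulr_sumr; apply: eq_bigr => j _.
by rewrite mxE normrM.
Qed.

Lemma sum_row_le_mxl1 B i : \sum_j `|B i j| <= (mxl1 B)%:rc.
Proof.
rewrite mxl1E [leRHS](bigD1 i) //= lerDl sumr_ge0 // => k _.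
by rewrite sumr_ge0.
Qed.

(** Multiplying by [B] on the left takes combinations along a row of [B], whose
moduli add up to at most [mxl1 B]. Bounding entries rather than [mxl1 (B ^+ k)]
makes the bound correct at [k = 0], where [mxl1 1%:M = n]. *)
Lemma norm_exprmx_le B k i j : `|(B ^+ k) i j| <= ((mxl1 B) ^+ k)%:rc.
Proof.
elim: k i => [|k IHk] i.
  by rewrite !expr0 rmorph1 mxE; case: eqP; rewrite ?normr1 ?normr0.
rewrite exprS mxE (le_trans (ler_norm_sum _ _ _)) //.
rewrite exprS rmorphM (le_trans _ (ler_wpM2r _ (sum_row_le_mxl1 B i))) //; last first.
  by rewrite -(rmorph0 embC) embC_le exprn_ge0 // mxl1_ge0.
rewrite mulr_suml ler_sum // => l _; rewrite normrM ler_wpM2l //.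
Qed.

Lemma norm_expterm_le B k i j : `|expterm B k i j| <= (exp_coeff (mxl1 B) k)%:rc.
Proof.
rewrite mxE normrM normfV normr_nat /exp_coeff /= rmorphM fmorphV rmorph_nat mulrC.
by rewrite ler_wpM2r ?invr_ge0 // norm_exprmx_le.
Qed.

Lemma series_mxE (u : nat -> 'M[C]_n) N i j :
  series u N i j = series (fun k => u k i j) N.
Proof. by rewrite /series /= summxE. Qed.

(** [expmx] is a limit by definition; what is proved is that the limit exists. *)
Lemma cvg_expmx B : series (expterm B) N @[N --> \oo] --> expmx B.
Proof.
have cB i j : cvgn (series (fun k => expterm B k i j)).
  apply: cvg_series_complex (is_cvg_series_exp_coeff (mxl1 B)) => k.
  exact: norm_expterm_le.
apply/cvg_ex; exists (\matrix_(i, j) limn (series (fun k => expterm B k i j))).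
apply/cvg_mx_entry => i j; rewrite mxE.
by under eq_cvg do rewrite series_mxE; exact: cB.
Qed.

Lemma expmx_unique B (L : 'M[C]_n) :
  series (expterm B) N @[N --> \oo] --> L -> expmx B = L.
Proof. by move=> cL; exact: (cvg_lim (@norm_hausdorff _ _) cL). Qed.

Lemma exptermD B D k : B *m D = D *m B ->
  expterm (B + D) k = \sum_(0 <= i < k.+1) expterm B i *m expterm D (k - i)%N.
Proof.
move=> BD; rewrite /expterm addrC (@exprDn_comm 'M[C]_n) //.
rewrite scaler_sumr big_mkord; apply: eq_bigr => i _.
rewrite -[_ *+ 'C(_, _)]scaler_nat scalerA invf_fact_bin -1?ltnS // -scalemxAl -scalemxAr scalerA.
congr (_ *: _); apply: commrX; apply: commr_sym; exact: commrX.
Qed.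

Lemma norm_mul_expterm_le B D k l i j :
  `|(expterm B k *m expterm D l) i j| <=
  (n%:R * (exp_coeff (mxl1 B) k * exp_coeff (mxl1 D) l))%:rc.
Proof.
rewrite mxE (le_trans (ler_norm_sum _ _ _)) //.
rewrite mulr_natl rmorphMn rmorphM /= -[n in _ *+ n]card_ord -sumr_const.
by rewrite ler_sum // => h _; rewrite normrM ler_pM // norm_expterm_le.
Qed.

(** The defect between the product of partial sums and the partial sum for [B + D]
consists of the terms above the antidiagonal, for matrices ([SE]) as for real
numbers ([eE]). Its matrix version is bounded by its real version, which tends to
0 by the addition formula for [expR]. *)
Lemma expmxD B D : B *m D = D *m B -> expmx (B + D) = expmx B *m expmx D.
Proof.
move=> BD.
pose b := mxl1 B; pose d := mxl1 D.
pose e (x : R) N := series (exp_coeff x) N.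
pose S (X : 'M[C]_n) N := series (expterm X) N.
have cvS X : S X N @[N --> \oo] --> expmx X by exact: cvg_expmx.
have eE N : e b N * e d N - e (b + d) N =
    \sum_(0 <= k < N) \sum_(N - k <= l < N) exp_coeff b k * exp_coeff d l.
  rewrite /e /series /= mulr_suml; under [X in X - _]eq_bigr do rewrite mulr_sumr.
  rewrite sum_nat_triangle; under [X in _ - X]eq_bigr do rewrite exp_coeffD.
  by rewrite addrAC subrr add0r.
have SE N : S B N *m S D N - S (B + D) N =
    \sum_(0 <= k < N) \sum_(N - k <= l < N) expterm B k *m expterm D l.
  rewrite /S /series /= mulmx_suml; under [X in X - _]eq_bigr do rewrite mulmx_sumr.
  rewrite sum_nat_triangle; under [X in _ - X]eq_bigr do rewrite exptermD //.
  by rewrite addrAC subrr add0r.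
(* An entry of a product of matrices has [n] terms, hence the factor [n%:R]. *)
have e0 : (n%:R * (e b N * e d N - e (b + d) N)) @[N --> \oo] --> (0 : R).
  have ce x : e x N @[N --> \oo] --> expR x by exact: is_cvg_series_exp_coeff.
  rewrite -[0](mulr0 n%:R) -[X in _ * X](subrr (expR (b + d))) [X in X - _]expRD.
  by apply: cvgMl_tmp; apply: cvgB => //; apply: cvgM.
have S0 : (S B N *m S D N - S (B + D) N) @[N --> \oo] --> (0 : 'M[C]_n).
  apply/cvg_mx_entry => i j; rewrite mxE.
  have E0 : (n%:R * (e b N * e d N - e (b + d) N))%:rc @[N --> \oo] --> (0 : C).
    by rewrite -(rmorph0 embC); exact: cvg_real_complex.
  apply: (cvg0_norm_le _ E0).
  apply: nearW => N.
  rewrite SE eE summxE (le_trans (ler_norm_sum _ _ _)) //.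
  rewrite mulr_sumr rmorph_sum ler_sum // => k _.
  rewrite summxE (le_trans (ler_norm_sum _ _ _)) //.
  rewrite mulr_sumr rmorph_sum ler_sum // => l _; exact: norm_mul_expterm_le.
apply/esym/subr0_eq; apply: cvg_unique S0; first exact: norm_hausdorff.
by apply: cvgB => //; exact: cvg_mulmx.
Qed.

(** The bound comes from [1 / (k + 2)! <= 1 / k!], which lets the factor
[mxl1 B ^+ 2] out of the tail of the series. *)
Lemma expmx_remainder_le B i j :
  `|(expmx B - 1%:M - B) i j| <= (mxl1 B ^+ 2 * expR (mxl1 B))%:rc.
Proof.
set b := mxl1 B.
have cR : (series (expterm B) N - 1%:M - B) i j @[N --> \oo] -->
    (expmx B - 1%:M - B) i j.
  move: i j; apply/cvg_mx_entry.
  by apply: cvgB; [apply: cvgB; [exact: cvg_expmx|exact: cvg_cst]|exact: cvg_cst].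
(* A partial sum with at least two terms contains both 1 and [B]. *)
apply: norm_cvg_le cR; exists 2%N => // -[|[|N]] // _.
have t0 : expterm B 0 = 1%:M by rewrite /expterm fact0 invr1 scale1r.
have t1 : expterm B 1 = B by rewrite /expterm expr1 invr1 scale1r.
rewrite /series /= big_nat_recl // big_nat_recl // t0 t1.
rewrite -[_ - 1%:M - B]addrA -opprD addrA [X in X - _]addrC addrK summxE.
rewrite (le_trans (ler_norm_sum _ _ _)) //.
apply: (@le_trans _ _ (b ^+ 2 * series (exp_coeff b) N)%:rc); last first.
  by rewrite embC_le ler_wpM2l ?exprn_ge0 ?series_exp_coeff_le_expR ?mxl1_ge0.
rewrite /series /= mulr_sumr rmorph_sum ler_sum // => k _.
apply: le_trans (norm_expterm_le _ _ _ _) _; rewrite embC_le /exp_coeff /=.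
rewrite -/b -addn2 exprD mulrAC mulrC.
have b0 : 0 <= b by exact: mxl1_ge0.
apply: ler_wpM2l; first exact: exprn_ge0.
apply: ler_wpM2l; first exact: exprn_ge0.
rewrite lef_pV2 ?posrE ?ltr0n ?fact_gt0 // ler_nat addn2 2!factS.
by rewrite mulnA leq_pmull.
Qed.

Lemma expmx0 : expmx (0 : 'M[C]_n) = 1%:M.
Proof.
have m0 : mxl1 0 = 0.
  apply: (@complexI R); rewrite -!/(embC _) mxl1E rmorph0 big1 // => i _.
  by rewrite big1 // => j _; rewrite mxE normr0.
apply/matrixP => i j; apply/eqP; rewrite -subr_eq0 -normr_le0.
have := expmx_remainder_le 0 i j.
by rewrite m0 expr0n mul0r rmorph0 subr0 !mxE.
Qed.

Lemma tr_expterm B k : (expterm B k)^T = expterm B^T k.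
Proof.
rewrite /expterm linearZ /=; congr (_ *: _).
by elim: k => [|k IHk]; rewrite ?expr0 ?trmx1// exprS exprSr trmx_mul IHk.
Qed.

Lemma tr_expmx B : (expmx B)^T = expmx B^T.
Proof.
apply/esym/expmx_unique; apply: cvg_trans (cvg_trmx (@cvg_expmx B)).
apply: near_eq_cvg; apply: nearW => N; rewrite [LHS]linear_sum /=.
by apply: eq_bigr => k _; exact: tr_expterm.
Qed.

Lemma cvg_expmx_difference_quotient B :
  h^-1 *: (expmx (h *: B) - 1%:M) @[h --> (0 : C)^'] --> B.
Proof.
pose b := mxl1 B; apply: (@cvg_mx_difference_quotient C n n _ _ _ (b ^+ 2 * expR b)%:rc).
near=> h; move=> i j.
(* [`|h| <= 1] keeps [expR (mxl1 (h *: B))] below the constant [expR b]. *)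
have h1 : cabs h <= 1.
  by rewrite -embC_le cabsE rmorph1; near: h; exact: near0_norm_le1.
have b0 : 0 <= b by exact: mxl1_ge0.
have a0 : 0 <= cabs h by rewrite -embC_le cabsE rmorph0.
apply: (le_trans (expmx_remainder_le _ _ _)).
rewrite -cabsE -rmorphXn -rmorphM embC_le mxl1Z exprMn -mulrA.
apply: ler_wpM2l; first exact: exprn_ge0.
apply: ler_wpM2l; first exact: exprn_ge0.
by rewrite ler_expR ler_piMl.
Unshelve. all: by end_near. Qed.

(** By the addition formula the difference quotient at [z] is the one at 0 times
[expmx (z *: B)]. *)
Lemma entire_expmxZ B : entire (fun z : C => expmx (z *: B)).
Proof.
move=> z; apply/cvg_ex; exists (B *m expmx (z *: B)).
have dE : h^-1 *: (expmx (h *: B) - 1%:M) *m expmx (z *: B) @[h --> (0 : C)^']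
    --> B *m expmx (z *: B).
  by apply: cvg_mulmx; [exact: cvg_expmx_difference_quotient|exact: cvg_cst].
apply: cvg_trans dE; apply: near_eq_cvg; apply: nearW => h /=.
have hz : (h *: B) *m (z *: B) = (z *: B) *m (h *: B).
  by rewrite -!scalemxAl -!scalemxAr !scalerA mulrC.
by rewrite -scalemxAl mulmxBl mul1mx -(expmxD hz) -scalerDl [_ *: 1]mulr1.
Qed.

End MatrixExponential.

Lemma expmx_eigen_blocks n (c : C) (B D : 'M[C]_n) : c ^+ 2 = -1 ->
  expmx (eigen_blocks c B D) = eigen_blocks c (expmx B) (expmx D).
Proof.
move=> c2; apply: expmx_unique.
under eq_cvg do rewrite series_expterm_eigen_blocks //.
by apply: cvg_eigen_blocks; exact: cvg_expmx.
Qed.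

Lemma expmx_sigma_y_tens n (z : C) (B : 'M[C]_n) :
  expmx (z *: sigma_y_tens B) =
  block_mx (coshmx (z *: B)) (- 'i%C *: sinhmx (z *: B))
           ('i%C *: sinhmx (z *: B)) (coshmx (z *: B)).
Proof.
have -> : z *: sigma_y_tens B = eigen_blocks ('i%C : C) (z *: B) (- (z *: B)).
  rewrite -scalerN -eigen_blocksZ eigen_blocksN; congr (_ *: _).
  exact: sigma_y_tensE.
rewrite expmx_eigen_blocks; last exact: sqr_i.
exact: eigen_blocksE.
Qed.

End ComplexExponential.

(** * Symmetry of the uniformised generator *)

(** Detailed balance says that [D ^+ 2 *m P] is symmetric, where [D] is
[sqrt_diag nu] and [P] is [uniformised Lam Q]. This matrix is [D *m A *m D], and
the symmetric invertible factors [D] can be cancelled. *)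
Lemma symmetrised_sym (R : realType) (M : nat) (Lam : R) (Q : 'M[R]_M) (nu : 'cV[R]_M) :
  (forall i, 0 < nu i 0) -> is_reversible Q nu ->
  (symmetrised Lam Q nu)^T = symmetrised Lam Q nu.
Proof.
move=> nu0 rev; set A := symmetrised _ _ _.
pose D := sqrt_diag nu; pose P := uniformised Lam Q.
have Du : D \in unitmx.
  rewrite unitmxE det_diag unitfE; apply/prodf_neq0 => i _.
  by rewrite mxE gt_eqF // sqrtr_gt0.
have DT : D^T = D by rewrite tr_diag_mx.
have DD : D *m D = diag_mx nu^T.
  rewrite mulmx_diag; congr diag_mx; apply/rowP => i.
  by rewrite !mxE -expr2 sqr_sqrtr // ltW.
have balance : (D *m D *m P)^T = D *m D *m P.
  rewrite DD mul_diag_mx; apply/matrixP => i j; rewrite !mxE !mulrDr.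
  congr (_ + _); last by rewrite !(mulrCA _ Lam^-1) rev.
  by rewrite eq_sym; case: eqVneq => [->//|_]; rewrite !mulr0.
have ADD : D *m A *m D = D *m D *m P by rewrite /A /symmetrised !mulmxA mulmxKV.
have : (D *m A *m D)^T = D *m A *m D by rewrite ADD.
by rewrite !trmx_mul DT mulmxA => /(can_inj (mulmxK Du)) /(can_inj (mulKmx Du)).
Qed.

(** * The group generated by K *)

Theorem theorem3p2 (R : realType) (M : nat) (hM : (2 <= M)%N)
    (Q : 'M[R]_M) (nu : 'cV[R]_M) (Lam : R)
    (hQ : is_generator Q) (hirr : is_irreducible Q)
    (hnu : is_stationary Q nu) (hrev : is_reversible Q nu)
    (hLam0 : 0 < Lam) (hLam : forall i, - Q i i <= Lam) :
  let A : 'M[R[i]]_M := complexmx (symmetrised Lam Q nu) in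
  let K : 'M[R[i]]_(M + M) := sigma_y_tens A in
  let W : R[i] -> 'M[R[i]]_(M + M) := fun z => expmx (z *: K) in
  (K^T = - K /\ K ^t* = K) /\
  [/\ entire W,
      forall z : R[i], W z \in orthogonal_group R[i] (M + M),
      forall z w : R[i], W (z + w) = W z *m W w,
      W 0 = 1%:M &
      forall z : R[i], (W z)^T *m W z = 1%:M] /\
  (forall z : R[i],
     W z = block_mx (coshmx (z *: A)) (- 'i%C *: sinhmx (z *: A))
                    ('i%C *: sinhmx (z *: A)) (coshmx (z *: A))).
Proof.
move=> A K W.
have AT : A^T = A.
  by rewrite /A /complexmx map_trmx (symmetrised_sym Lam (is_stationary_gt0 hQ hirr hnu) hrev).
have KT : K^T = - K.
  rewrite /K sigma_y_tensE tr_block_mx !trmx0 !linearZ /= AT.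
  by rewrite opp_block_mx !oppr0 scaleNr opprK.
have KH : K ^t* = K.
  rewrite KT /K sigma_y_tensE opp_block_mx map_block_mx !oppr0 !map_mx0.
  rewrite scaleNr opprK.
  have Aconj : map_mx Num.conj A = A.
    by apply/matrixP => i j; rewrite !mxE; exact: conjc_real.
  by rewrite -!scaleNr !map_mxZ Aconj [_ (- _)]rmorphN /= complexiE conjCi opprK.
have WD z w : W (z + w) = W z *m W w.
  rewrite /W scalerDl; apply: expmxD.
  by rewrite -!scalemxAl -!scalemxAr !scalerA mulrC.
have W0 : W 0 = 1%:M by rewrite /W scale0r; exact: expmx0.
have WT z : (W z)^T *m W z = 1%:M.
  rewrite (_ : (W z)^T = W (- z)).
    by rewrite -WD addNr.
  rewrite /W; apply: etrans; first exact: tr_expmx.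
  by rewrite linearZ /= KT scalerN scaleNr.
split; first by [].
split; last by move=> z; exact: expmx_sigma_y_tens.
split => //; first exact: entire_expmxZ.
by move=> z; rewrite inE; exact: WT.
Qed.
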